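(* Let $I=[0,1]$ and let $\mathrm{Homeo}_+(I)$ be the group of orientation-preserving homeomorphisms of $I$ with the topology of uniform convergence. Then $\mathrm{Homeo}_+(I)$ is generically topologically $2$-generated; that is, the set $$\{(f,g)\in \mathrm{Homeo}_+(I)^2 : \langle f,g\rangle \text{ is dense in } \mathrm{Homeo}_+(I)\}$$ is comeager in $\mathrm{Homeo}_+(I)^2$.
   Context: $\mathrm{Homeo}_+(I)$ is the group, under composition, of increasing homeomorphisms of $[0,1]$ onto itself, topologized by the uniform metric $\rho(f,g)=\sup_{x\in I}|f(x)-g(x)|$; it is a Polish group. $\langle f,g\rangle$ denotes the subgroup generated by $f$ and $g$. A subset of a topological space is comeager if it contains a countable intersection of dense open subsets. A Polish group $G$ is generically topologically $n$-generated if the set of $n$-tuples in $G^n$ generating a dense subgroup of $G$ is comeager in $G^n$ (product topology). *)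

(* Defs.v *)
From HB Require Import structures.
From mathcomp Require Import all_boot all_order all_algebra.
From mathcomp Require Import all_classical all_reals all_analysis.
From mathcomp Require Import borel_hierarchy.

Set Implicit Arguments.
Unset Strict Implicit.
Unset Printing Implicit Defensive.

Import Order.TTheory GRing.Theory Num.Theory.
Import numFieldNormedType.Exports.

Local Open Scope classical_set_scope.
Local Open Scope ring_scope.

Definition comeager (T : topologicalType) (A : set T) : Prop :=
  exists2 U : set T, Gdelta_dense U & U `<=` A.

Definition is_subgroup (G : groupType) (H : set G) : Prop :=
  [/\ H 1%g, forall x y, H x -> H y -> H (x * y)%g & forall x, H x -> H x^-1%g].

Definition generated_subgroup (G : groupType) (S : set G) : set G :=
  smallest (@is_subgroup G) S.

Definition homeomorphism (T U : topologicalType) (f : T -> U) : Prop :=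
  continuous f /\ exists g : U -> T, [/\ cancel f g, cancel g f & continuous g].

(* A type, with the subtype topology inherited from R. *)
Notation unitI R := (set_type (`[0 : R, 1 : R]%classic)).

Record homeo_plus (R : realType) := HomeoPlus {
  homeo_fun :> unitI R -> unitI R;
  homeo_homeomorphism : homeomorphism homeo_fun;
  homeo_increasing : forall x y : unitI R, val x < val y ->
    val (homeo_fun x) < val (homeo_fun y)
}.

Section homeo_plus_structures.
Context {R : realType}.
Implicit Types f g h : homeo_plus R.

Lemma homeo_plusP f g : f =1 g -> f = g.
Proof.
case: f g => [f hf mf] [g hg mg] /= /funext fg; subst g.
by rewrite (Prop_irrelevance hf hg) (Prop_irrelevance mf mg).
Qed.

HB.instance Definition _ := gen_eqMixin (homeo_plus R).
HB.instance Definition _ := gen_choiceMixin (homeo_plus R).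

Lemma homeo_one_homeomorphism : homeomorphism (id : unitI R -> unitI R).
Proof. by split; [|exists id; split] => // x; apply: cvg_id. Qed.

Definition homeo_one : homeo_plus R :=
  HomeoPlus homeo_one_homeomorphism (fun _ _ => id).

Lemma homeo_mul_homeomorphism f g : homeomorphism (f \o g).
Proof.
have [cf [f' [fK f'K cf']]] := homeo_homeomorphism f.
have [cg [g' [gK g'K cg']]] := homeo_homeomorphism g.
split; first by move=> x; apply: continuous_comp; [exact: cg | exact: cf].
exists (g' \o f'); split; [exact: can_comp | exact: can_comp |].
by move=> x; apply: continuous_comp; [exact: cf' | exact: cg'].
Qed.

Lemma homeo_mul_increasing f g (x y : unitI R) : val x < val y ->
  val ((f \o g) x) < val ((f \o g) y).
Proof. by move=> xy; do 2 apply: homeo_increasing. Qed.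

Definition homeo_mul f g : homeo_plus R :=
  HomeoPlus (homeo_mul_homeomorphism f g) (@homeo_mul_increasing f g).

Definition homeo_inv_fun f : unitI R -> unitI R :=
  sval (cid (homeo_homeomorphism f).2).

Lemma homeo_inv_funP f : [/\ cancel f (homeo_inv_fun f),
  cancel (homeo_inv_fun f) f & continuous (homeo_inv_fun f)].
Proof. by rewrite /homeo_inv_fun; case: cid. Qed.

Lemma homeo_inv_homeomorphism f : homeomorphism (homeo_inv_fun f).
Proof.
have [fK f'K cf'] := homeo_inv_funP f; split=> //.
by exists f; split=> //; have [] := homeo_homeomorphism f.
Qed.

Lemma homeo_inv_increasing f (x y : unitI R) : val x < val y ->
  val (homeo_inv_fun f x) < val (homeo_inv_fun f y).
Proof.
have [_ f'K _] := homeo_inv_funP f.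
move=> xy; rewrite ltNge le_eqVlt; apply/negP => /orP[/eqP/val_inj yx|yx].
  by move: xy; rewrite -(f'K x) -(f'K y) yx ltxx.
have := @homeo_increasing _ f _ _ yx; rewrite !f'K => /(lt_trans xy).
by rewrite ltxx.
Qed.

Definition homeo_inv f : homeo_plus R :=
  HomeoPlus (homeo_inv_homeomorphism f) (@homeo_inv_increasing f).

Lemma homeo_mulA : associative homeo_mul.
Proof. by move=> f g h; apply: homeo_plusP. Qed.

Lemma homeo_mul1g : left_id homeo_one homeo_mul.
Proof. by move=> f; apply: homeo_plusP. Qed.

Lemma homeo_mulg1 : right_id homeo_one homeo_mul.
Proof. by move=> f; apply: homeo_plusP. Qed.

Lemma homeo_mulVg : left_inverse homeo_one homeo_inv homeo_mul.
Proof.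
by move=> f; apply: homeo_plusP => x /=; have [fK _ _] := homeo_inv_funP f.
Qed.

Lemma homeo_mulgV : right_inverse homeo_one homeo_inv homeo_mul.
Proof.
by move=> f; apply: homeo_plusP => x /=; have [_ f'K _] := homeo_inv_funP f.
Qed.

HB.instance Definition _ := isGroup.Build (homeo_plus R)
  homeo_mulA homeo_mul1g homeo_mulg1 homeo_mulVg homeo_mulgV.

Lemma homeo_mulE f g x : (f * g)%g x = f (g x). Proof. by []. Qed.

Lemma homeo_oneE x : (1%g : homeo_plus R) x = x. Proof. by []. Qed.

Definition homeo_dist f g : R :=
  sup (range (fun x : unitI R => `|val (f x) - val (g x)|)).

Let unitI_bound (x : unitI R) : 0 <= val x <= 1.
Proof. by have := set_valP x; rewrite /= in_itv. Qed.

Let unitI0 : unitI R.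
Proof. by exists 0; rewrite inE /= in_itv /= lexx ler01. Defined.

Lemma homeo_dist_has_sup f g :
  has_sup (range (fun x : unitI R => `|val (f x) - val (g x)|)).
Proof.
split; first by exists `|val (f unitI0) - val (g unitI0)|, unitI0.
exists 1 => _ [x _ <-]; rewrite ler_norml.
have /andP[f0 f1] := unitI_bound (f x); have /andP[g0 g1] := unitI_bound (g x).
rewrite lerBrDr lerBlDr; apply/andP; split.
  by apply: le_trans f0; rewrite addrC subr_le0.
by apply: le_trans f1 _; rewrite lerDl.
Qed.

Lemma homeo_dist_ub f g x : `|val (f x) - val (g x)| <= homeo_dist f g.
Proof.
by apply: sup_upper_bound; [exact: homeo_dist_has_sup | exists x].
Qed.

Lemma homeo_dist_le f g e :
  (forall x, `|val (f x) - val (g x)| <= e) -> homeo_dist f g <= e.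
Proof.
move=> fge; apply: ge_sup; first by case: (homeo_dist_has_sup f g).
by move=> _ [x _ <-].
Qed.

Lemma homeo_distxx f : homeo_dist f f = 0.
Proof.
apply/eqP; rewrite eq_le homeo_dist_le => [|x]; last by rewrite subrr normr0.
exact: le_trans (normr_ge0 _) (homeo_dist_ub f f unitI0).
Qed.

Lemma homeo_dist_positivity f g : homeo_dist f g = 0 -> f = g.
Proof.
move=> fg0; apply: homeo_plusP => x; apply/val_inj/eqP.
rewrite -subr_eq0 -normr_le0; apply: le_trans (homeo_dist_ub f g x) _.
by rewrite fg0.
Qed.

Lemma homeo_dist_sym f g : homeo_dist f g = homeo_dist g f.
Proof.
apply/eqP; rewrite eq_le; apply/andP; split; apply: homeo_dist_le => x;
  by rewrite distrC; exact: homeo_dist_ub.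
Qed.

Lemma homeo_dist_triangle g f h :
  homeo_dist f h <= homeo_dist f g + homeo_dist g h.
Proof.
apply: homeo_dist_le => x; apply: le_trans (ler_distD (val (g x)) _ _) _.
by apply: lerD; exact: homeo_dist_ub.
Qed.

HB.instance Definition _ := isMetric.Build R (homeo_plus R)
  homeo_distxx homeo_dist_positivity homeo_dist_sym homeo_dist_triangle.

End homeo_plus_structures.

(* Main.v *)
Require Import Defs.
From mathcomp Require Import all_boot all_order all_algebra.
From mathcomp Require Import all_classical all_reals all_analysis.
From mathcomp Require Import lra ring.

Set Implicit Arguments.
Unset Strict Implicit.
Unset Printing Implicit Defensive.
Import Order.TTheory GRing.Theory Num.Theory.
Import numFieldNormedType.Exports.
Local Open Scope classical_set_scope.

(** As Homeo_+(I) is separable and words are continuous in their letters, it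
    suffices to prove that, for each h and e, the open set of the pairs (f, g)
    some word of which is e-close to h is dense. Given (f0, g0), perturb f0 to f
    with finitely many fixed points in (0, 1), g0 to g1 moving these fixed
    points and equal to the identity near 0, and h to h' supported on some
    [[a, z]] inside (0, 1). As f and g1 have no common fixed point in (0, 1),
    some word u(f, g1) brings z into the region where g1 is the identity. There
    f has no fixed point, so a power v of f brings u(z) below a level [xi] under
    which the values of g1 do not matter to the action of u on [[a, 1]]. With
    W = v u, the map g2 = g1 W h' W^-1 differs from g1 only below [xi], so
    W' = v u(f, g2) still agrees with W on [[a, 1]], and the word W'^-1 g2 W'
    in f and g2 equals h' on [[0, z]]. *)

(** * Homeomorphisms as increasing real functions on [[0, 1]] *)

Section evaluation.
Local Open Scope ring_scope.
Context {R : realType}.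
Implicit Types (f g h : homeo_plus R) (x y a b : R).

Lemma clamp_subproof x : Num.max 0 (Num.min 1 x) \in `[0, 1]%classic.
Proof. by rewrite inE/= in_itv/= le_max lexx ge_max ler01 ge_min lexx. Qed.

Definition clamp x : unitI R := exist (fun t => t \in `[0, 1]%classic) _ (clamp_subproof x).

Lemma clampK x : 0 <= x <= 1 -> val (clamp x) = x.
Proof. by move=> /andP[x0 x1]; rewrite /= min_r// max_r. Qed.

Lemma unitI_itv (t : unitI R) : 0 <= val t <= 1.
Proof. by have := set_valP t; rewrite /= in_itv. Qed.

Lemma val_clamp (t : unitI R) : clamp (val t) = t.
Proof. by apply: val_inj; rewrite clampK// unitI_itv. Qed.

(* [f] on [[0, 1]], extended by constants outside; this avoids the subtype. *)
Definition ev f x : R := val (f (clamp x)).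

Lemma ev_val f (t : unitI R) : val (f t) = ev f (val t).
Proof. by rewrite /ev val_clamp. Qed.

Lemma ev_itv f x : 0 <= ev f x <= 1. Proof. exact: unitI_itv. Qed.

Lemma ev_ge0 f x : 0 <= ev f x. Proof. by case/andP: (ev_itv f x). Qed.

Lemma ev_le1 f x : ev f x <= 1. Proof. by case/andP: (ev_itv f x). Qed.

Lemma evM f g x : ev (f * g)%g x = ev f (ev g x).
Proof. by rewrite /ev homeo_mulE val_clamp. Qed.

Lemma ev1g x : 0 <= x <= 1 -> ev 1%g x = x.
Proof. by move=> x01; rewrite /ev homeo_oneE clampK. Qed.

Lemma ev_lt f x y : 0 <= x -> x < y -> y <= 1 -> ev f x < ev f y.
Proof. by move=> x0 xy y1; apply: homeo_increasing; rewrite !clampK//; lra. Qed.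

Lemma ev_le f x y : 0 <= x -> x <= y -> y <= 1 -> ev f x <= ev f y.
Proof.
by move=> x0; rewrite le_eqVlt => /predU1P[->//|xy] y1; apply/ltW/ev_lt.
Qed.

Lemma evK f x : 0 <= x <= 1 -> ev f^-1%g (ev f x) = x.
Proof. by move=> x01; rewrite -evM mulVg ev1g. Qed.

Lemma evKV f x : 0 <= x <= 1 -> ev f (ev f^-1%g x) = x.
Proof. by move=> x01; rewrite -evM mulgV ev1g. Qed.

Lemma ev0 f : ev f 0 = 0.
Proof.
apply/eqP; rewrite eq_le ev_ge0 andbT -[leRHS](evKV f) ?lexx ?ler01//.
by rewrite ev_le ?ev_ge0 ?ev_le1.
Qed.

Lemma ev1 f : ev f 1 = 1.
Proof.
apply/eqP; rewrite eq_le ev_le1 -[leLHS](evKV f) ?lexx ?ler01//.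
by rewrite ev_le ?ev_ge0 ?ev_le1.
Qed.

Lemma ev_gt0 f x : 0 < x -> x <= 1 -> 0 < ev f x.
Proof. by move=> x0 x1; rewrite -[ltLHS](ev0 f) ev_lt. Qed.

Lemma ev_lt1 f x : 0 <= x -> x < 1 -> ev f x < 1.
Proof. by move=> x0 x1; rewrite -[ltRHS](ev1 f) ev_lt. Qed.

Lemma ev_le_inv f x y : 0 <= x <= 1 -> 0 <= y <= 1 -> ev f x <= ev f y -> x <= y.
Proof.
move=> /andP[x0 x1] /andP[y0 y1] fxy; rewrite leNgt; apply/negP => yx.
by have := ev_lt f y0 yx x1; rewrite ltNge fxy.
Qed.

(** Each of the values [p t - e] and [p t + e] that lies in [[0, 1]] is attained, at a point given
    by [q], and as [p] reflects the order these points bound a neighbourhood of [t]. If such a value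
    falls outside [[0, 1]], that side imposes no condition. *)
Lemma increasing_onto_eps_delta (p q : unitI R -> unitI R) :
  (forall s t, val s < val t -> val (p s) < val (p t)) -> cancel q p ->
  forall t (e : R), 0 < e -> exists2 d : R, 0 < d &
    forall s, `|val t - val s| < d -> `|val (p t) - val (p s)| < e.
Proof.
move=> pm qK t e e0.
have pI s r : val (p s) < val (p r) -> val s < val r.
  move=> psr; rewrite ltNge le_eqVlt; apply/negP => /orP[/eqP/val_inj e'|/pm].
    by move: psr; rewrite e' ltxx.
  by move/(lt_trans psr); rewrite ltxx.
have [d d0 dP] : exists2 d : R, 0 < d &
    forall s, val t - d < val s -> val (p t) - e < val (p s).
  have [ye|ye] := ltP (val (p t)) e.
    exists 1 => // s _; have /andP[+ _] := unitI_itv (p s).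
    by apply: lt_le_trans; rewrite subr_lt0.
  pose r := q (clamp (val (p t) - e)).
  have pr : val (p r) = val (p t) - e.
    have /andP[_ y1] := unitI_itv (p t).
    by rewrite qK clampK// subr_ge0 ye lerBlDr (le_trans y1)// lerDl ltW.
  exists (val t - val r) => [|s]; first by rewrite subr_gt0 pI// pr gtrBl.
  by rewrite subKr -pr => /pm.
have [d' d'0 dP'] : exists2 d : R, 0 < d &
    forall s, val s < val t + d -> val (p s) < val (p t) + e.
  have [ye|ye] := ltP 1 (val (p t) + e).
    by exists 1 => // s _; have /andP[_ /le_lt_trans] := unitI_itv (p s); apply.
  pose r := q (clamp (val (p t) + e)).
  have pr : val (p r) = val (p t) + e.
    have /andP[y0 _] := unitI_itv (p t).
    by rewrite qK clampK// ye andbT addr_ge0// ltW.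
  exists (val r - val t) => [|s]; first by rewrite subr_gt0 pI// pr ltrDl.
  by rewrite addrC subrK -pr => /pm.
exists (Num.min d d') => [|s]; first by rewrite lt_min d0.
have {dP} := dP s; have {dP'} := dP' s.
move: (val s : R) (val t : R) (val (p s) : R) (val (p t) : R) => a b a' b'.
rewrite lt_min !ltr_norml => H H' /andP[/andP[? ?] /andP[? ?]].
have := H ltac:(lra); have := H' ltac:(lra); lra.
Qed.

Lemma increasing_onto_continuous (p q : unitI R -> unitI R) :
  (forall s t, val s < val t -> val (p s) < val (p t)) -> cancel q p ->
  continuous p.
Proof.
move=> pm qK.
suff cp : continuous (val \o p : unitI R -> R).
  exact: continuous_comp_initial cp.
move=> t; apply/(@cvgrPdist_lt _ _ _ (nbhs t) (nbhs_filter t)) => e e0 /=.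
have [d d0 dP] := increasing_onto_eps_delta pm qK t e0.
have := @initial_continuous _ _ (val : unitI R -> R) t.
move/(@cvgrPdist_lt _ _ _ (nbhs t) (nbhs_filter t)) => /(_ _ d0).
by apply: filterS => s; exact: dP.
Qed.

(** The inverse of an increasing bijection is increasing and onto too, so continuity holds in both
    directions. The explicit homeomorphisms below are all obtained this way. *)
Lemma homeo_plus_of_increasing_onto (F : R -> R) :
  (forall x, 0 <= x <= 1 -> 0 <= F x <= 1) ->
  (forall x y, 0 <= x -> x < y -> y <= 1 -> F x < F y) ->
  (forall y, 0 <= y <= 1 -> exists2 x, 0 <= x <= 1 & F x = y) ->
  exists f, forall x, 0 <= x <= 1 -> ev f x = F x.
Proof.
move=> F01 Fm Fs.
pose p (t : unitI R) := clamp (F (val t)).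
have pE t : val (p t) = F (val t) by rewrite clampK// F01// unitI_itv.
have pm s t : val s < val t -> val (p s) < val (p t).
  move=> st; rewrite !pE; have /andP[? _] := unitI_itv s.
  by have /andP[_ ?] := unitI_itv t; apply: Fm.
have ps t : exists s, p s = t.
  have [x x01 Fx] := Fs _ (unitI_itv t).
  by exists (clamp x); apply: val_inj; rewrite pE clampK.
pose q t := sval (cid (ps t)).
have qK : cancel q p by move=> t; rewrite /q; case: cid.
have pI s t : p s = p t -> s = t.
  move=> st; apply: val_inj; apply/eqP; rewrite eq_le !leNgt.
  by apply/andP; split; apply/negP => /pm; rewrite st ltxx.
have pK : cancel p q by move=> t; apply: pI; rewrite qK.
have qm s t : val s < val t -> val (q s) < val (q t).
  move=> st; rewrite ltNge le_eqVlt; apply/negP => /orP[/eqP/val_inj e|/pm].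
    by move: st; rewrite -(qK s) -(qK t) e ltxx.
  by rewrite !qK => /(lt_trans st); rewrite ltxx.
have hp : homeomorphism p.
  split; first exact: increasing_onto_continuous pm qK.
  by exists q; split => //; apply: increasing_onto_continuous qm pK.
exists (HomeoPlus hp pm) => x x01.
by rewrite /ev -[HomeoPlus hp pm _]/(p (clamp x)) pE clampK.
Qed.

End evaluation.

(** * Uniform distance, grids and separability *)

Section metric.
Local Open Scope ring_scope.
Context {R : realType}.
Implicit Types (f g h : homeo_plus R) (x y a b e : R).

Lemma ev_dist f g x : `|ev f x - ev g x| <= homeo_dist f g.
Proof. exact: homeo_dist_ub. Qed.

Lemma dist_ev f g e : (forall x, 0 <= x <= 1 -> `|ev f x - ev g x| <= e) ->
  homeo_dist f g <= e.
Proof.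
by move=> H; apply: homeo_dist_le => t; rewrite !ev_val; apply/H/unitI_itv.
Qed.

(** Both maps agree at [b], so both send [[0, b]] into [[0, ev g b]]. Hence a change near 0 costs
    little, whatever it is. *)
Lemma dist_eq_right f g b : 0 <= b <= 1 ->
  (forall x, b <= x <= 1 -> ev f x = ev g x) -> homeo_dist f g <= ev g b.
Proof.
move=> /andP[b0 b1] fg; apply: dist_ev => x /andP[x0 x1].
have [bx|/ltW xb] := leP b x; first by rewrite fg ?bx// subrr normr0 ev_ge0.
have := ev_le f x0 xb b1; have := ev_le g x0 xb b1.
rewrite -(fg b) ?lexx// ler_norml; move: (ev_ge0 f x) (ev_ge0 g x).
by move: (ev f x) (ev g x) (ev f b) => *; lra.
Qed.

Lemma dist_eq_left f g b : 0 <= b <= 1 ->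
  (forall x, 0 <= x <= b -> ev f x = ev g x) -> homeo_dist f g <= 1 - ev g b.
Proof.
move=> /andP[b0 b1] fg; apply: dist_ev => x /andP[x0 x1].
have [xb|/ltW bx] := leP x b.
  by rewrite fg ?x0// subrr normr0 subr_ge0 ev_le1.
have := ev_le f b0 bx x1; have := ev_le g b0 bx x1.
rewrite -(fg b) ?b0 ?lexx// ler_norml; move: (ev_le1 f x) (ev_le1 g x).
by move: (ev f x) (ev g x) (ev f b) => *; lra.
Qed.

Lemma grid_cell (N : nat) x : (0 < N)%N -> 0 <= x <= 1 ->
  exists2 i, (i < N)%N & i%:R / N%:R <= x <= i.+1%:R / N%:R.
Proof.
move=> N0 /andP[x0 x1].
have : x <= N%:R / N%:R by rewrite divff// pnatr_eq0 -lt0n.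
(* The induction is on the number of cells covered; the denominators keep the fixed [N]. *)
elim: {1 2 4}N N0 => // -[_ _ x1'|n IH _ xn].
  by exists 0%N; rewrite // mulr0n mul0r x0.
have [/IH[//|i ni xi]|/ltW nx] := leP x (n.+1%:R / N%:R).
  by exists i => //; exact: ltnW.
by exists n.+1; rewrite // nx.
Qed.

Lemma grid_itv (N i : nat) : (i <= N)%N -> 0 <= (i%:R / N%:R : R) <= 1.
Proof.
case: N => [|N] iN; first by rewrite invr0 mulr0 lexx ler01.
by rewrite divr_ge0// ler_pdivrMr// mul1r ler_nat.
Qed.

Lemma grid_lt (N i : nat) : (0 < N)%N -> (i%:R / N%:R : R) < i.+1%:R / N%:R.
Proof. by move=> N0; rewrite ltr_pM2r ?invr_gt0 ?ltr0n// ltr_nat. Qed.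

Lemma small_mesh e : 0 < e -> exists2 N : nat, (0 < N)%N & N%:R^-1 < e.
Proof.
move=> e0; have e1 : 0 <= e^-1 by rewrite invr_ge0 ltW.
exists (Num.bound e^-1).+1 => //; rewrite invf_plt ?posrE ?ltr0n//.
by apply: lt_le_trans (archi_boundP e1) _; rewrite ler_nat.
Qed.

Lemma min_positive (u : nat -> R) n : (forall i, (i < n)%N -> 0 < u i) ->
  exists2 d, 0 < d & forall i, (i < n)%N -> d <= u i.
Proof.
elim: n => [_|n IH u0]; first by exists 1.
have [i /ltnW/u0//|d d0 dP] := IH.
exists (Num.min d (u n)) => [|i]; first by rewrite lt_min d0 u0.
by rewrite ltnS leq_eqVlt ge_min => /predU1P[->|/dP->//]; rewrite lexx orbT.
Qed.

(** Pull back by [f] a grid of mesh less than [e / 2], and let [d] be the least gap between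
    consecutive preimages. Points closer than [d] lie in the same or in adjacent cells, so their
    images differ by at most two meshes. *)
Lemma ev_unif_continuous f e : 0 < e -> exists2 d, 0 < d & forall x y,
  0 <= x <= 1 -> 0 <= y <= 1 -> `|x - y| < d -> `|ev f x - ev f y| < e.
Proof.
move=> e0; have [N N0 Ne] := small_mesh (divr_gt0 e0 (ltr0n _ 2)).
pose p i := ev f^-1%g (i%:R / N%:R).
have [i iN|d d0 dP] := @min_positive (fun i => p i.+1 - p i) N.
  have /andP[? _] := grid_itv (ltnW iN); have /andP[_ ?] := grid_itv iN.
  by rewrite subr_gt0 ev_lt// grid_lt.
have fp i : (i <= N)%N -> ev f (p i) = i%:R / N%:R.
  by move=> iN; rewrite evKV// grid_itv.
exists d => //; suff key x y : 0 <= x <= 1 -> 0 <= y <= 1 -> x <= y ->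
    y < x + d -> ev f y < ev f x + e.
  move=> x y x01 y01; rewrite !ltr_norml => xyd.
  have [xy|/ltW yx] := leP x y.
    have := key _ _ x01 y01 xy ltac:(lra); have /andP[? ?] := x01.
    have /andP[? y1] := y01; have := ev_le f _ xy y1.
    by move/(_ ltac:(lra)); lra.
  have := key _ _ y01 x01 yx ltac:(lra); have /andP[? x1] := x01.
  have /andP[? ?] := y01; have := ev_le f _ yx x1.
  by move/(_ ltac:(lra)); lra.
move=> x01 y01 xy yxd.
have [i iN /andP[ix xi]] := grid_cell N0 (ev_itv f x).
have step k : k.+1%:R / N%:R = k%:R / N%:R + N%:R^-1 :> R.
  by rewrite -natr1 mulrDl mul1r.
have px : x <= p i.+1 by apply: (@ev_le_inv _ f); rewrite ?ev_itv ?fp.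
have [iN2|iN2] := leqP i.+2 N.
  have yp : y <= p i.+2 by have := dP _ iN2; rewrite /p in px *; lra.
  have /andP[y0 _] := y01.
  have := ev_le f y0 yp (ev_le1 _ _); rewrite fp// !step.
  lra.
(* In the last cell there is no next preimage; the bound [ev f y <= 1] replaces it. *)
have := ev_le1 f y; have iNE : i.+1 = N by apply/eqP; rewrite eqn_leq iN.
have := step i; rewrite iNE divff ?pnatr_eq0 -?lt0n//.
lra.
Qed.

(** By monotonicity, on a cell both maps lie between their values at its two ends. *)
Lemma dist_grid f g (N : nat) t d : (0 < N)%N ->
  (forall i, (i <= N)%N ->
    `|ev f (i%:R / N%:R) - ev g (i%:R / N%:R)| <= t) ->
  (forall i, (i < N)%N ->
    ev g (i.+1%:R / N%:R) - ev g (i%:R / N%:R) <= d) ->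
  homeo_dist f g <= t + d.
Proof.
move=> N0 fgt gd; apply: dist_ev => x x01; have /andP[x0 x1] := x01.
have [i iN /andP[ix xi]] := grid_cell N0 x01.
have /andP[i0 _] : 0 <= (i%:R / N%:R : R) <= 1 by rewrite grid_itv// ltnW.
have /andP[_ i1] : 0 <= (i.+1%:R / N%:R : R) <= 1 by rewrite grid_itv.
have := ev_le f i0 ix x1; have := ev_le g i0 ix x1.
have := ev_le f x0 xi i1; have := ev_le g x0 xi i1.
have := fgt _ iN; have := fgt _ (ltnW iN); have := gd _ iN.
by rewrite !ler_norml; move: (ev f _) (ev f _) (ev f _) (ev g _) (ev g _) (ev g _) => *; lra.
Qed.

Lemma fine_grid f e : 0 < e -> exists2 N0 : nat, (0 < N0)%N &
  forall N, (N0 <= N)%N -> forall i, (i < N)%N ->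
    ev f (i.+1%:R / N%:R) - ev f (i%:R / N%:R) < e.
Proof.
move=> e0; have [d d0 dP] := ev_unif_continuous f e0.
have [M M0 Md] := small_mesh d0; exists M => // N MN i iN.
apply: le_lt_trans (ler_norm _) _; apply: dP; rewrite ?grid_itv//; first exact: ltnW.
rewrite -mulrBl -natrB// subSnn mul1r ger0_norm ?invr_ge0//.
by apply: le_lt_trans Md; rewrite lef_pV2 ?posrE ?ltr0n ?ler_nat// (leq_trans M0).
Qed.

(** A code is a mesh [N] and a list of integers, the integer parts of the values at the grid points
    scaled by [N]. Choose one homeomorphism for each code that is realized, and the identity for the
    others. Two homeomorphisms with the same code differ by at most [1 / N] on the grid, hence by
    little everywhere once the grid is fine for [f]. *)
Lemma homeo_plus_separable :
  exists h : nat -> homeo_plus R, forall f e, 0 < e ->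
    exists n, homeo_dist (h n) f < e.
Proof.
pose P (c : nat * seq nat) (h : homeo_plus R) := forall i, (i <= c.1)%N ->
  (nth 0%N c.2 i)%:R <= c.1%:R * ev h (i%:R / c.1%:R) < (nth 0%N c.2 i).+1%:R.
pose H (c : nat * seq nat) : homeo_plus R :=
  if pselect (exists h, P c h) is left ex then sval (cid ex) else 1%g.
exists (fun n => if unpickle n is Some c then H c else 1%g) => f e e0.
have e2 := divr_gt0 e0 (ltr0n _ 2).
have [N1 _ N1P] := fine_grid f e2; have [N2 N20 N2P] := small_mesh e2.
pose N := maxn N1 N2; have N0 : (0 < N)%N by rewrite leq_max N20 orbT.
have Ninv : N%:R^-1 < e / 2.
  by apply: le_lt_trans N2P; rewrite lef_pV2 ?posrE ?ltr0n// ler_nat leq_maxr.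
pose c := (N, [seq Num.truncn (N%:R * ev f (i%:R / N%:R)) | i <- iota 0 N.+1]).
have Pf : P c f.
  move=> i iN; rewrite (nth_map 0%N) ?size_iota// nth_iota// add0n.
  by apply: truncn_itv; rewrite mulr_ge0// ev_ge0.
exists (pickle c); rewrite pickleK /H; case: pselect => [ex|[]]; last by exists f.
case: cid => h /= Ph; apply: (@le_lt_trans _ _ (N%:R^-1 + e / 2)); last first.
  by move: (N%:R^-1) Ninv => *; lra.
apply: (dist_grid N0) => i iN; last by apply/ltW/N1P => //; rewrite leq_maxl.
have := Ph i iN; have := Pf i iN.
rewrite -natr1 /c/=; move: (ev h _) (ev f _) ((nth _ _ _)%:R) => u v w.
have NR : 0 < N%:R :> R by rewrite ltr0n.
move=> /andP[? ?] /andP[? ?]; rewrite -(ler_pM2l NR) divff ?gt_eqF//.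
by rewrite -{1}(gtr0_norm NR) -normrM mulrBr ler_norml; lra.
Qed.

End metric.

(** * Gluing and perturbing homeomorphisms *)

Section constructions.
Local Open Scope ring_scope.
Context {R : realType}.
Implicit Types (f g h k : homeo_plus R) (x y a b c e : R).

(** The condition [ev f a < ev k b] makes the connecting segment increasing. All local modifications
    below are splices. *)
Lemma splice f k a b : 0 <= a -> a < b -> b <= 1 -> ev f a < ev k b ->
  exists m : homeo_plus R,
    [/\ forall x, 0 <= x <= a -> ev m x = ev f x,
        forall x, b <= x <= 1 -> ev m x = ev k x &
        forall x, a <= x <= b ->
          ev m x = ev f a + (x - a) * ((ev k b - ev f a) / (b - a))].
Proof.
move=> a0 ab b1 fk; have a1 := ltW (lt_le_trans ab b1); have b0 := le_lt_trans a0 ab.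
set s := (_ / _); have s0 : 0 < s by rewrite divr_gt0// subr_gt0.
pose l x := ev f a + (x - a) * s.
have la : l a = ev f a by rewrite /l subrr mul0r addr0.
have lb : l b = ev k b.
  by rewrite /l /s mulrCA divff ?mulr1 ?subr_eq0 ?gt_eqF// addrC subrK.
have l_lt x y : x < y -> l x < l y.
  by move=> xy; rewrite ltrD2l ltr_pM2r// ltrD2r.
have l_le x y : x <= y -> l x <= l y by rewrite le_eqVlt => /predU1P[->//|/l_lt/ltW].
pose F x := if x <= a then ev f x else if b <= x then ev k x else l x.
have Fl x : a <= x <= b -> F x = l x.
  move=> /andP[ax xb]; rewrite /F; case: leP => [xa|_].
    by have -> : x = a by apply/eqP; rewrite eq_le xa.
  by case: leP => // bx; have -> : x = b by apply/eqP; rewrite eq_le xb.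
have Fk x : b <= x -> F x = ev k x.
  by move=> bx; rewrite /F leNgt (lt_le_trans ab bx)/= bx.
have Ff x : x <= a -> F x = ev f x by rewrite /F => ->.
have [m mF] : exists m : homeo_plus R, forall x, 0 <= x <= 1 -> ev m x = F x.
  apply: homeo_plus_of_increasing_onto => [x /andP[x0 x1]|x y x0 xy y1|y /andP[y0 y1]].
  - have [/Ff->|/ltW ax] := leP x a; first exact: ev_itv.
    have [/Fk->|/ltW xb] := leP b x; first exact: ev_itv.
    rewrite Fl ?ax//; apply/andP; split.
      by apply: le_trans (ev_ge0 f a) _; rewrite -la l_le.
    by apply: le_trans (ev_le1 k b); rewrite -lb l_le.
  - have F_f u v : 0 <= u -> u < v -> v <= a -> F u < F v.
      move=> u0 uv va; rewrite !Ff//; last exact: le_trans (ltW uv) va.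
      by rewrite ev_lt// (le_trans va).
    have F_l u v : a <= u -> u < v -> v <= b -> F u < F v.
      move=> au uv vb; rewrite !Fl ?l_lt ?au ?vb ?andbT ?(le_trans (ltW uv))//.
      exact: le_trans au (ltW uv).
    have F_k u v : b <= u -> u < v -> v <= 1 -> F u < F v.
      move=> bu uv v1; rewrite !Fk// ?ev_lt ?(le_trans (ltW b0))//.
      exact: le_trans bu (ltW uv).
    have F_b u v : a <= u -> u < v -> v <= 1 -> F u < F v.
      move=> au uv v1; have [vb|bv] := leP v b; first exact: F_l.
      have [bu|ub] := leP b u; first exact: F_k.
      by apply: (lt_trans (F_l u b _ _ _)) => //; apply: F_k.
    have [ya|ay] := leP y a; first exact: F_f.
    have [ax|xa] := leP a x; first exact: F_b.
    by apply: (lt_trans (F_f x a _ _ _)) => //; apply: F_b.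
  - have y01 : 0 <= y <= 1 by rewrite y0.
    have [ya|ay] := leP y (ev f a).
      exists (ev f^-1%g y); first exact: ev_itv.
      by rewrite Ff ?evKV// (@ev_le_inv _ f) ?ev_itv ?a0// evKV.
    have [by_|yb] := leP (ev k b) y.
      exists (ev k^-1%g y); first exact: ev_itv.
      by rewrite Fk ?evKV// (@ev_le_inv _ k) ?ev_itv ?(ltW b0)// evKV.
    pose x := a + (y - ev f a) / s.
    have lx : l x = y.
      by rewrite /l /x [a + _]addrC addrK divfK ?gt_eqF// addrC subrK.
    have ax : a <= x by rewrite lerDl divr_ge0 ?(ltW s0)// subr_ge0 ltW.
    have xb : x <= b.
      by rewrite leNgt; apply/negP => /l_lt; rewrite lx lb ltNge (ltW yb).
    exists x; first by rewrite (le_trans a0 ax) (le_trans xb b1).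
    by rewrite Fl ?ax.
exists m; split => x /andP[? ?].
- by rewrite mF ?Ff//; apply/andP; split => //; apply: le_trans a1.
- by rewrite mF ?Fk//; apply/andP; split => //; apply: le_trans (ltW b0) _.
- rewrite mF ?Fl//; first by apply/andP.
  by apply/andP; split; [apply: le_trans a0 _|apply: le_trans b1].
Qed.

(** In the coordinate [x / (1 - x)] this map is division by [c]. The inverse has the same form with
    [1 / c] for [c]. *)
Lemma moebius_homeo c : 0 < c ->
  exists t : homeo_plus R, forall x, 0 <= x <= 1 -> ev t x = x / (x + c * (1 - x)).
Proof.
move=> c0; have den x : 0 <= x <= 1 -> 0 < x + c * (1 - x).
  move=> /andP[x0 x1]; move: x0; rewrite le_eqVlt => /predU1P[<-|x0].
    by rewrite add0r subr0 mulr1.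
  by rewrite ltr_pwDl// mulr_ge0 ?(ltW c0)// subr_ge0.
apply: homeo_plus_of_increasing_onto => [x x01|x y x0 xy y1|y y01].
- have /andP[x0 x1] := x01; rewrite divr_ge0 ?(ltW (den _ _))//=.
  by rewrite ler_pdivrMr ?den// mul1r lerDl mulr_ge0 ?(ltW c0)// subr_ge0.
- have x01 : 0 <= x <= 1 by rewrite x0 (le_trans (ltW xy)).
  have y01 : 0 <= y <= 1 by rewrite y1 (le_trans x0 (ltW xy)).
  rewrite ltr_pdivrMr ?den// mulrAC ltr_pdivlMr ?den//; nra.
- have /andP[y0 y1] := y01.
  have d0 : 0 < 1 - y + c * y.
    by have := den (1 - y); rewrite subKr; apply; rewrite subr_ge0 y1 lerBlDr lerDl.
  exists (c * y / (1 - y + c * y)).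
    rewrite divr_ge0 ?(ltW d0) ?mulr_ge0 ?(ltW c0)//=.
    by rewrite ler_pdivrMr// mul1r lerDr subr_ge0.
  field; apply/andP; split; first by rewrite gt_eqF.
  rewrite (_ : _ + _ = c) ?gt_eqF//; ring.
Qed.

Lemma avoid_seq (s : seq R) a b : a < b -> exists c, a < c < b /\ c \notin s.
Proof.
elim: s a b => [|z s IH] a b ab.
  by exists ((a + b) / 2); split => //; lra.
have [/andP[az zb]|nz] := boolP (a < z < b).
  have [c [/andP[ac cz] cs]] := IH _ _ az; exists c; rewrite ac (lt_trans cz zb).
  by rewrite inE negb_or cs (lt_eqF cz).
have [c [acb cs]] := IH _ _ ab; exists c; split => //.
by rewrite inE negb_or cs andbT; apply: contraNneq nz => <-.
Qed.

(** Compose [f] with the Moebius map of parameter [c]. For each [z] in [(0, 1)], the composite fixes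
    [z] for the single value [c = bad z], so some [c] in [(1, 1 + e)] avoids the finitely many bad
    values; the displacement is at most [c - 1]. *)
Lemma unfix_seq f e (s : seq R) : 0 < e ->
  exists2 f' : homeo_plus R, homeo_dist f' f < e &
    forall z, z \in s -> 0 < z < 1 -> ev f' z != z.
Proof.
move=> e0.
pose bad z := ev f z * (1 - z) / (z * (1 - ev f z)).
have e1 : 1 < 1 + e by rewrite ltrDl.
have [c [/andP[c1 ce] cs]] := avoid_seq [seq bad z | z <- s] e1.
have c0 : 0 < c by apply: lt_trans c1.
have [t tE] := moebius_homeo c0; exists (t * f)%g.
  apply: (@le_lt_trans _ _ (c - 1)); last by rewrite ltrBlDl.
  apply: dist_ev => x _; rewrite evM tE ?ev_itv//.
  move: (ev f x) (ev_itv f x) => y /andP[y0 y1].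
  have d1 : 1 <= y + c * (1 - y) by nra.
  have d0 : 0 < y + c * (1 - y) by apply: lt_le_trans d1.
  rewrite ler_norml; apply/andP; split.
    rewrite opprB lerBrDr ler_pdivlMr//; nra.
  by rewrite lerBlDr ler_pdivrMr//; nra.
move=> z zs /andP[z0 z1]; apply: contraNneq cs => tz.
apply/mapP; exists z => //; rewrite /bad.
have y0 := ev_gt0 f z0 (ltW z1); have y1 := ev_lt1 f (ltW z0) z1.
move: tz; rewrite evM tE ?ev_itv//; move: (ev f z) y0 y1 => y y0 y1.
have d0 : 0 < y + c * (1 - y) by nra.
move/(congr1 ( *%R^~ (y + c * (1 - y)))); rewrite divfK ?gt_eqF// => yz.
rewrite (_ : y * (1 - z) = c * (z * (1 - y))); last by lra.
by rewrite mulfK// mulf_neq0 ?gt_eqF// subr_gt0.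
Qed.

(** Two distinct fixed points force slope 1, so the affine map is the identity and fixes both ends
    [u] and [v]. *)
Lemma affine_fixpoint_unique u v x y p q : u < v ->
  p + (x - u) * ((q - p) / (v - u)) = x ->
  p + (y - u) * ((q - p) / (v - u)) = y -> p != u \/ q != v -> x = y.
Proof.
move=> uv; set s := (_ / _) => xs ys pq.
apply/eqP/negPn/negP => xy.
have s1 : s = 1.
  have /eqP : (x - y) * (s - 1) = 0 by lra.
  by rewrite mulf_eq0 !subr_eq0 (negbTE xy) => /eqP.
have qE : q = p + s * (v - u) by rewrite /s divfK ?subr_eq0 ?gt_eqF// addrC subrK.
by case: pq => /negP; apply; apply/eqP; move: xs; rewrite ?qE s1; lra.
Qed.

(* Take [f'] affine on each cell of a fine grid and moving the interior grid
   points: each cell then contains at most one fixed point. *)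
Lemma finite_fixpoints f e : 0 < e ->
  exists2 f' : homeo_plus R, homeo_dist f' f < e &
    exists s : seq R, forall x, 0 < x < 1 -> ev f' x = x -> x \in s.
Proof.
move=> e0; have e3 : 0 < e / 3 by rewrite divr_gt0.
have [N1 _ fine] := fine_grid f e3; pose N := maxn N1 2.
have N2 : (1 < N)%N by rewrite leq_maxr.
have N0 : (0 < N)%N by apply: ltnW.
have [f1 f1f f1N] := unfix_seq f [seq i%:R / N%:R | i <- iota 0 N] e3.
have f1_fix i : (0 < i < N)%N -> ev f1 (i%:R / N%:R) != i%:R / N%:R.
  move=> /andP[i0 iN]; apply: f1N.
    by apply/mapP; exists i => //; rewrite mem_iota.
  by rewrite divr_gt0 ?ltr0n//= ltr_pdivrMr ?ltr0n// mul1r ltr_nat.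
(* The cells are made affine one by one from the left, keeping the values of [f1] on the grid. *)
have [f2 f2f1 [s f2s]] : exists2 f2 : homeo_plus R,
    forall i, (i <= N)%N -> ev f2 (i%:R / N%:R) = ev f1 (i%:R / N%:R) &
    exists s : seq R, forall x, 0 < x <= N%:R / N%:R -> x < 1 -> ev f2 x = x -> x \in s.
  elim: {1 6}N (leqnn N) => [_|n IH nN].
    exists f1 => //; exists [::] => x; rewrite mulr0n mul0r => /andP[x0 x0'].
    by move: x0; rewrite ltNge x0'.
  have [f2 f2f1 [s f2s]] := IH (ltnW nN).
  have /andP[a0 _] := @grid_itv R _ _ (ltnW nN); have /andP[_ b1] := @grid_itv R _ _ nN.
  have ab := @grid_lt R _ n N0.
  have [f3 [f3a f3b f3ab]] := splice a0 ab b1 (ev_lt f2 a0 ab b1).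
  exists f3 => [i iN|].
    rewrite -f2f1//; have /andP[i0 i1] := @grid_itv R _ _ iN.
    have [ni|ni] := leqP i n.
      by rewrite f3a// i0 ler_pM2r ?invr_gt0 ?ltr0n// ler_nat.
    by rewrite f3b// i1 andbT ler_pM2r ?invr_gt0 ?ltr0n// ler_nat.
  pose fixed x := n%:R / N%:R <= x <= n.+1%:R / N%:R /\ ev f3 x = x.
  have fixed_unique x y : fixed x -> fixed y -> x = y.
    move=> [xab xE] [yab yE]; move: (xE) (yE); rewrite !f3ab// => xE' yE'.
    apply: (affine_fixpoint_unique ab xE' yE').
    (* The ends 0 and 1 stay fixed, but as [N] is at least 2 every cell has an interior grid point
       as an end: the right one for the first cell, the left one for the others. *)
    rewrite !f2f1// ?(ltnW nN)//; case: (posnP n) => n0; [right|left].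
      by apply: f1_fix; rewrite n0.
    by apply: f1_fix; rewrite n0.
  have [s' s'P] : exists s' : seq R, forall x, fixed x -> x \in s'.
    have [[y fy]|nf] := pselect (exists y, fixed y); last first.
      by exists [::] => x fx; case: nf; exists x.
    by exists [:: y] => x fx; rewrite inE (fixed_unique _ _ fx fy).
  exists (s ++ s') => x /andP[x0 xb] x1 fx; rewrite mem_cat.
  have [ax|/ltW xa] := leP (n%:R / N%:R) x.
    by rewrite s'P ?orbT//; split; rewrite ?ax.
  by rewrite f2s// ?x0// -f3a// xa (ltW x0).
exists f2; last first.
  exists s => x /andP[x0 x1]; apply: f2s => //.
  by rewrite x0 divff ?(ltW x1)// pnatr_eq0 -lt0n.
apply: (@le_lt_trans _ _ (e / 3 + e / 3)); last by lra.
apply: (dist_grid N0) => i iN; last by apply/ltW/fine; rewrite ?leq_maxl.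
by rewrite f2f1//; apply: le_trans (ltW f1f); exact: ev_dist.
Qed.

Lemma seq_pos_lower_bound (s : seq R) :
  exists2 m, 0 < m & forall z, z \in s -> 0 < z -> m <= z.
Proof.
elim: s => [|y s [m m0 mP]]; first by exists 1.
have [y0|y0] := ltP 0 y; last first.
  exists m => // z; rewrite inE => /predU1P[->|/mP//].
  by rewrite ltNge y0.
exists (Num.min y m) => [|z]; first by rewrite lt_min y0.
rewrite inE ge_min => /predU1P[->|zs z0]; first by rewrite lexx.
by rewrite mP ?orbT.
Qed.

Lemma unfix_seq_id_near0 f e (s : seq R) : 0 < e ->
  exists f' : homeo_plus R, exists eta : R,
    [/\ homeo_dist f' f < e, 0 < eta < 1,
        forall x, 0 <= x <= eta -> ev f' x = x &
        forall z, z \in s -> 0 < z < 1 -> ev f' z != z].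
Proof.
move=> e0; have e2 : 0 < e / 2 by rewrite divr_gt0.
have [f1 f1f f1s] := unfix_seq f s e2.
have [m m0 mP] := seq_pos_lower_bound s.
have [d d0 dP] := ev_unif_continuous f1 e2.
(* Below [m] there are no positive points of [s], so changing [f1] on [[0, b]] does not affect them;
   [d / 2] makes [ev f1 b] small, and [1 / 2] keeps [b] below 1. *)
pose b := Num.min m (Num.min (d / 2) (1 / 2)).
have b0 : 0 < b by rewrite !lt_min m0 !divr_gt0.
have b1 : b < 1 by rewrite !gt_min (_ : 1 / 2 < 1) ?orbT//; lra.
have bm : b <= m by rewrite ge_min lexx.
have bd : b < d by rewrite !gt_min (_ : d / 2 < d) ?orbT//; lra.
have b01 : 0 <= b <= 1 by rewrite !ltW.
have fb : ev f1 b < e / 2.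
  rewrite -[ltLHS]subr0 -{1}(ev0 f1); apply: le_lt_trans (ler_norm _) _.
  by apply: dP; rewrite ?lexx ?ler01// subr0 gtr0_norm.
have fb0 := ev_gt0 f1 b0 (ltW b1).
(* Splicing the identity on [[0, eta]] to [f1] on [[b, 1]] requires [eta < b] and
   [eta < ev f1 b]. *)
pose eta := Num.min b (ev f1 b) / 2.
have eta0 : 0 < eta by rewrite divr_gt0// lt_min b0.
have eta_lt : eta < Num.min b (ev f1 b).
  by rewrite ltr_pdivrMr// mulr2n mulrDr mulr1 ltrDl lt_min b0.
have [etab etaf] : eta < b /\ eta < ev f1 b by apply/andP; rewrite -lt_min.
have eta1 : eta < 1 by apply: lt_trans b1.
have fe : ev 1%g eta < ev f1 b by rewrite ev1g// !ltW.
have [f' [f'1 f'f _]] := splice (ltW eta0) etab (ltW b1) fe.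
exists f', eta; split => [||x /andP[x0 xe]|z zs /andP[z0 z1]].
- apply: le_lt_trans (homeo_dist_triangle f1 _ _) _.
  rewrite [ltRHS]splitr ltrD//.
  by apply: le_lt_trans (dist_eq_right b01 f'f) _.
- exact/andP.
- by rewrite f'1 ?x0// ev1g// x0 (le_trans xe (ltW eta1)).
- by rewrite f'f ?f1s ?z0// (ltW z1) (le_trans bm (mP _ zs z0)).
Qed.

(** The left end is the preceding lemma with no points to move; a splice with the identity treats
    the right end. The bound on [1 - z] limits the error of a word that is known to equal [h'] on
    [[0, z]] only. *)
Lemma identity_near_ends h e : 0 < e ->
  exists h' : homeo_plus R, exists a z : R,
    [/\ homeo_dist h' h < e, 0 < a, a < z, z < 1 & 1 - z < e] /\
    (forall x, 0 <= x <= a -> ev h' x = x) /\ (forall x, z <= x <= 1 -> ev h' x = x).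
Proof.
move=> e0; have e2 : 0 < e / 2 by rewrite divr_gt0.
have [h1 [a [h1h /andP[a0 a1] h1a _]]] := unfix_seq_id_near0 h [::] e2.
have [d d0 dP] := ev_unif_continuous h1 e2.
pose y := Num.max a (Num.max (1 - d / 2) (1 - e / 2)).
have ay : a <= y by rewrite le_max lexx.
have y0 : 0 < y by apply: lt_le_trans ay.
have y1 : y < 1 by rewrite !gt_max a1/=; apply/andP; split; lra.
have yd : 1 - d / 2 <= y by rewrite !le_max lexx !orbT.
have ye : 1 - e / 2 <= y by rewrite !le_max lexx !orbT.
have y01 : 0 <= y <= 1 by rewrite !ltW.
have hy : 1 - ev h1 y < e / 2.
  rewrite -{1}(ev1 h1); apply: le_lt_trans (ler_norm _) _.
  by apply: dP; rewrite ?lexx ?ler01// gtr0_norm; lra.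
have hy1 := ev_lt1 h1 (ltW y0) y1.
pose z := (Num.max y (ev h1 y) + 1) / 2.
have max1 : Num.max y (ev h1 y) < 1 by rewrite gt_max y1.
have z1 : z < 1 by rewrite /z; lra.
have [yz hyz] : y < z /\ ev h1 y < z.
  by apply/andP; rewrite -gt_max /z; lra.
have fe : ev h1 y < ev 1%g z by rewrite ev1g// (ltW z1) (ltW (lt_trans y0 yz)).
have [h' [h'h h'1 _]] := splice (ltW y0) yz (ltW z1) fe.
exists h', a, z; split; [split|split] => //.
- apply: le_lt_trans (homeo_dist_triangle h1 _ _) _.
  rewrite [ltRHS]splitr ltrD//.
  by apply: le_lt_trans (dist_eq_left y01 h'h) _.
- exact: le_lt_trans yz.
- by lra.
- by move=> x /andP[x0 xa]; rewrite h'h ?h1a ?x0// (le_trans xa).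
- move=> x /andP[zx x1]; rewrite h'1 ?zx// ev1g// x1 andbT.
  by apply: le_trans zx; exact: ltW (lt_trans y0 yz).
Qed.

End constructions.

(** * The subgroup generated by a set *)

Section generated_subgroup.
Context {G : groupType}.
Implicit Types (S T : set G) (x y : G).

Lemma gen_is_subgroup S : is_subgroup (generated_subgroup S).
Proof.
split=> [M [[]]//|x y Sx Sy M MS|x Sx M MS].
  by have [[_ MM _] _] := MS; apply: MM; [exact: Sx|exact: Sy].
by have [[_ _ MV] _] := MS; apply: MV; exact: Sx.
Qed.

Lemma gen1 S : generated_subgroup S 1%g.
Proof. by have [] := gen_is_subgroup S. Qed.

Lemma genM S x y : generated_subgroup S x -> generated_subgroup S y ->
  generated_subgroup S (x * y)%g.
Proof. by have [_ + _] := gen_is_subgroup S; apply. Qed.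

Lemma genV S x : generated_subgroup S x -> generated_subgroup S x^-1%g.
Proof. by have [_ _] := gen_is_subgroup S; apply. Qed.

Lemma sub_gen S x : S x -> generated_subgroup S x.
Proof. exact: sub_gen_smallest. Qed.

(** This serves as induction on words, with [T] the set of elements having the desired property. *)
Lemma gen_sub S T : is_subgroup T -> S `<=` T -> generated_subgroup S `<=` T.
Proof. exact: smallest_sub. Qed.

Lemma gen_mono S T : S `<=` T -> generated_subgroup S `<=` generated_subgroup T.
Proof.
by move=> ST; apply: (gen_sub (gen_is_subgroup T)) => x /ST; exact: sub_gen.
Qed.

End generated_subgroup.

(** * Orbits of points and stability of words *)

Section words.
Local Open Scope ring_scope.
Context {R : realType}.
Implicit Types (f g h k u v w : homeo_plus R) (x y a b p e xi : R).
Notation gen2 f g := (generated_subgroup [set f; g]).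

(* The infimum of the orbit of [p] is fixed by the group. *)
Lemma orbit_near0 (S : set (homeo_plus R)) p xi : 0 < xi -> 0 < p <= 1 ->
  (forall x, 0 < x <= p -> exists2 k, S k & ev k x != x) ->
  exists2 w, generated_subgroup S w & ev w p < xi.
Proof.
move=> xi0 /andP[p0 p1] noFix; have p01 : 0 <= p <= 1 by rewrite ltW.
pose O := [set ev w p | w in generated_subgroup S].
have hO : has_inf O.
  split; first by exists (ev 1%g p), 1%g => //; exact: gen1.
  by exists 0 => _ [w _ <-]; exact: ev_ge0.
have ilb w : generated_subgroup S w -> inf O <= ev w p.
  by move=> Sw; apply: ge_inf; [exact: hO.2|exists w].
have i0 : 0 <= inf O by apply: (lb_le_inf hO.1) => _ [w _ <-]; exact: ev_ge0.
suff iE : inf O = 0.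
  have [_ [w Sw <-]] := inf_adherent xi0 hO.
  by rewrite iE add0r; exists w.
apply/eqP; rewrite eq_le i0 andbT leNgt; apply/negP => i_gt0.
have ip : inf O <= p by rewrite -[leRHS](ev1g p01); apply: ilb; exact: gen1.
have i1 : inf O <= 1 by apply: le_trans p1.
have i01 : 0 <= inf O <= 1 by rewrite i0.
(* If [k] lowered the infimum, some orbit point would lie below its image under [k^-1], and [k]
   would send that point below the infimum. Applied to [k] and [k^-1], this shows that the infimum
   is fixed. *)
have down k : generated_subgroup S k -> inf O <= ev k (inf O).
  move=> Sk; rewrite leNgt; apply/negP => ki.
  have ik : inf O < ev k^-1%g (inf O).
    by rewrite -{1}(evK k i01); apply: ev_lt => //; exact: ev_ge0.
  have gap : 0 < ev k^-1%g (inf O) - inf O by rewrite subr_gt0.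
  have [_ [w Sw <-]] := inf_adherent gap hO.
  rewrite addrC subrK => wk.
  have := ev_lt k (ev_ge0 w p) wk (ev_le1 _ _).
  by rewrite evKV// ltNge -evM ilb//; exact: genM.
have [|k Sk /eqP ki] := noFix (inf O); first by rewrite i_gt0.
apply: ki; apply/eqP; rewrite eq_le; apply/andP; split; last by apply: down; exact: sub_gen.
rewrite -[leRHS](evKV k i01); apply: ev_le; rewrite ?ev_ge0 ?ev_le1//.
by apply: down; apply: genV; exact: sub_gen.
Qed.

(* A word only sees finitely many points of the forward trajectory of [a]. *)
Lemma word_local f g u a : gen2 f g u -> 0 < a <= 1 ->
  exists2 xi, 0 < xi & forall g',
    (forall x, xi <= x <= 1 -> ev g' x = ev g x) ->
    exists2 u', gen2 f g' u' & forall x, a <= x <= 1 -> ev u' x = ev u x.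
Proof.
move=> fgu; move: u fgu a.
apply: (@gen_sub _ _ [set u | forall a, 0 < a <= 1 -> exists2 xi, 0 < xi &
  forall g', (forall x, xi <= x <= 1 -> ev g' x = ev g x) ->
  exists2 u', gen2 f g' u' & forall x, a <= x <= 1 -> ev u' x = ev u x]).
  split=> [a a01|u v Hu Hv a a01|u Hu a a01].
  - by exists 1 => // g' _; exists 1%g => //; exact: gen1.
  - have /andP[a0 a1] := a01.
    have [xv xv0 Hxv] := Hv _ a01.
    (* As [v] maps [[a, 1]] onto [[ev v a, 1]], the factor [u] has to be controlled on the latter
       interval. *)
    have va01 : 0 < ev v a <= 1 by rewrite ev_gt0// ev_le1.
    have [xu xu0 Hxu] := Hu _ va01.
    exists (Num.min xu xv) => [|g' g'g]; first by rewrite lt_min xu0.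
    have [x /andP[xx x1]|v' Gv' v'v] := Hxv g'.
      by apply: g'g; rewrite ge_min xx orbT.
    have [x /andP[xx x1]|u' Gu' u'u] := Hxu g'.
      by apply: g'g; rewrite ge_min xx.
    exists (u' * v')%g => [|x /andP[ax x1]]; first exact: genM.
    by rewrite !evM v'v ?ax// u'u// ev_le1 ev_le// ltW.
  - have /andP[a0 a1] := a01; have a01' : 0 <= a <= 1 by rewrite ltW.
    have va01 : 0 < ev u^-1%g a <= 1 by rewrite ev_gt0// ev_le1.
    have [xi xi0 Hxi] := Hu _ va01; exists xi => // g' /Hxi[u' Gu' u'u].
    exists u'^-1%g => [|x /andP[ax x1]]; first exact: genV.
    have x01 : 0 <= x <= 1 by rewrite x1 (le_trans _ ax)// ltW.
    rewrite -{1}(evKV u x01) -u'u ?evK ?ev_itv//.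
    by rewrite ev_le1 ev_le// ltW.
move=> _ [->|->] a /andP[a0 a1].
  by exists 1 => // g' _; exists f => //; apply: sub_gen; left.
by exists a => // g' g'g; exists g' => //; apply: sub_gen; right.
Qed.

(** By induction on the word: products and inverses are controlled by the uniform continuity of the
    unperturbed [u] and [u^-1]. This yields the openness of the approximation conditions. *)
Lemma word_continuous f g w e : gen2 f g w -> 0 < e ->
  exists2 d : R, 0 < d & forall f' g', homeo_dist f' f < d -> homeo_dist g' g < d ->
    exists2 w', gen2 f' g' w' & homeo_dist w' w < e.
Proof.
move=> fgw; move: w fgw e.
apply: (@gen_sub _ _ [set w | forall e, 0 < e ->
  exists2 d : R, 0 < d & forall f' g', homeo_dist f' f < d -> homeo_dist g' g < d ->
    exists2 w', gen2 f' g' w' & homeo_dist w' w < e]).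
  split=> [e e0|u v Hu Hv e e0|u Hu e e0].
  - by exists 1 => // f' g' _ _; exists 1%g; [exact: gen1|rewrite homeo_distxx].
  - have e2 : 0 < e / 2 by rewrite divr_gt0.
    have e4 : 0 < e / 4 by rewrite divr_gt0.
    have [c c0 cP] := ev_unif_continuous u e4.
    have [du du0 Hdu] := Hu _ e2; have [dv dv0 Hdv] := Hv _ c0.
    exists (Num.min du dv) => [|f' g']; first by rewrite lt_min du0.
    rewrite !lt_min => /andP[fu fv] /andP[gu gv].
    have [u' Gu' u'u] := Hdu _ _ fu gu; have [v' Gv' v'v] := Hdv _ _ fv gv.
    exists (u' * v')%g; first exact: genM.
    apply: (@le_lt_trans _ _ (homeo_dist u' u + e / 4)); last by lra.
    apply: dist_ev => x _; rewrite !evM.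
    apply: le_trans (ler_distD (ev u (ev v' x)) _ _) _.
    rewrite lerD ?ev_dist//; apply/ltW/cP; rewrite ?ev_itv//.
    exact: le_lt_trans (ev_dist _ _ _) v'v.
  - have e2 : 0 < e / 2 by rewrite divr_gt0.
    have [c c0 cP] := ev_unif_continuous u^-1%g e2.
    have [d d0 Hd] := Hu _ c0; exists d => // f' g' f'f g'g.
    have [u' Gu' u'u] := Hd _ _ f'f g'g; exists u'^-1%g; first exact: genV.
    apply: (@le_lt_trans _ _ (e / 2)); last by lra.
    (* With [x] the image of [y] under [u'^-1], the two values compared are the images under [u^-1]
       of the close points [ev u x] and [ev u' x]. *)
    apply: dist_ev => y y01; rewrite -{2}(evKV u' y01).
    rewrite -{1}(evK u (ev_itv u'^-1%g y)) distrC.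
    apply/ltW/cP; rewrite ?ev_itv//.
    exact: le_lt_trans (ev_dist _ _ _) u'u.
move=> _ [->|->] e e0; exists e => // f' g' f'f g'g.
  by exists f' => //; apply: sub_gen; left.
by exists g' => //; apply: sub_gen; right.
Qed.

End words.

(** * Density of the approximation conditions *)

Section density.
Local Open Scope ring_scope.
Context {R : realType}.
Implicit Types (f g h k u v w : homeo_plus R) (x y a e : R).
Notation gen2 f g := (generated_subgroup [set f; g]).

Lemma approx_pair f0 g0 h e : 0 < e -> exists f g w,
  [/\ homeo_dist f f0 < e, homeo_dist g g0 < e, gen2 f g w & homeo_dist w h < e].
Proof.
move=> e0; have e2 : 0 < e / 2 by rewrite divr_gt0.
have [f ff0 [s fs]] := finite_fixpoints f0 e0.
have [g1 [eta [g1g0 /andP[eta0 eta1] g1id g1s]]] := unfix_seq_id_near0 g0 s e2.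
have [h' [a [z [[h'h a0 az z1 ze] [h'a h'z]]]]] := identity_near_ends h e2.
have z0 : 0 < z by apply: lt_trans az.
have a1 : a < 1 by apply: lt_trans z1.
have z01 : 0 <= z <= 1 by rewrite !ltW.
have h'aE : ev h' a = a by rewrite h'a// lexx ltW.
have h'zE : ev h' z = z by rewrite h'z// lexx ltW.
have [u Gu uz] : exists2 u, gen2 f g1 u & ev u z < eta.
  apply: orbit_near0 => //; first by rewrite z0 ltW.
  move=> x /andP[x0 xz]; have x1 : x < 1 by apply: le_lt_trans z1.
  have [fx|fx] := eqVneq (ev f x) x; last by exists f => //; left.
  by exists g1; [right|apply: g1s; rewrite ?x0 ?fs ?x0].
have [xi1 xi10 u_local] : exists2 xi, 0 < xi & forall g',
    (forall x, xi <= x <= 1 -> ev g' x = ev g1 x) ->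
    exists2 u', gen2 f g' u' & forall x, a <= x <= 1 -> ev u' x = ev u x.
  by apply: word_local => //; rewrite a0 ltW.
(* Changes of [g1] below [xi] spare the action of [u] on [[a, 1]] by [xi1], take place where [g1] is
   the identity by [eta], and are small by [e / 4]. *)
pose xi := Num.min xi1 (Num.min eta (e / 4)).
have xi0 : 0 < xi by rewrite !lt_min xi10 eta0 divr_gt0.
have xi_xi1 : xi <= xi1 by rewrite ge_min lexx.
have xi_eta : xi <= eta by rewrite !ge_min lexx orbT.
have xi_e : xi <= e / 4 by rewrite !ge_min lexx !orbT.
have xi1' : xi <= 1 by rewrite (le_trans xi_eta)// ltW.
(* Below [eta] the map [g1] is the identity, yet it moves every fixed point of [f] in [(0, 1)]; so
   [f] has none there. Since [v] involves [f] alone, it remains a word after [g1] is replaced. *)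
have [v Gv vuz] : exists2 v, generated_subgroup [set f] v & ev v (ev u z) < xi.
  apply: orbit_near0 => //; first by rewrite ev_gt0 ?ev_le1// ltW.
  move=> x /andP[x0 xu]; exists f => //; apply/eqP => fx.
  have xeta : x < eta by apply: le_lt_trans uz.
  have x01 : 0 < x < 1 by rewrite x0 (lt_trans xeta).
  by have /eqP := g1s x (fs x x01 fx) x01; apply; rewrite g1id// !ltW.
(* The conjugate [c] is the identity outside [[ev W a, ev W z]], which lies below [xi]. *)
pose W := (v * u)%g; pose c := (W * h' * W^-1)%g; pose g2 := (g1 * c)%g.
have Wz : ev W z < xi by rewrite evM.
have cE x : ev c x = ev W (ev h' (ev W^-1%g x)) by rewrite -!evM.
have g2E x : ev g2 x = ev g1 (ev c x) by rewrite evM.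
have g2g1 x : xi <= x <= 1 -> ev g2 x = ev g1 x.
  move=> /andP[xix x1]; have x0 : 0 <= x by apply: le_trans xix; exact: ltW.
  have x01 : 0 <= x <= 1 by rewrite x0.
  rewrite g2E cE h'z ?evKV//; apply/andP; split; last exact: ev_le1.
  by rewrite (@ev_le_inv _ W) ?ev_itv// evKV// (le_trans (ltW Wz)).
have [x /andP[xix x1]|u' Gu' u'u] := u_local g2.
  by apply: g2g1; rewrite x1 andbT (le_trans xi_xi1).
pose W' := (v * u')%g.
have W'W x : a <= x <= 1 -> ev W' x = ev W x by move=> ax; rewrite !evM u'u.
have GW' : gen2 f g2 W'.
  by apply: genM Gu'; apply: gen_mono Gv => _ ->; left.
have g1_small y : 0 <= y -> y <= ev W z -> ev g1 y = y.
  by move=> y0 yW; rewrite g1id// y0 (le_trans yW)// (le_trans (ltW Wz)).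
pose w := (W'^-1 * g2 * W')%g.
have wE x : ev w x = ev W'^-1%g (ev g2 (ev W' x)) by rewrite -!evM.
have wh' x : 0 <= x <= z -> ev w x = ev h' x.
  move=> /andP[x0 xz]; have x1 : x <= 1 by apply: le_trans (ltW z1).
  have x01 : 0 <= x <= 1 by rewrite x0.
  have a01 : 0 <= a <= 1 by rewrite !ltW.
  (* On [[a, z]], [W'] agrees with [W] and [g1] is the identity on the values met, so conjugating
     back gives [h']. Below [a] the two may differ, but [W'] still maps into [[0, ev W a]], where
     [g2] is the identity; thus [w] fixes [x], as does [h']. *)
  have [ax|/ltW xa] := leP a x.
    have h'x0 : a <= ev h' x.
      by rewrite -[leLHS]h'aE ev_le// ltW.
    have h'xz : ev h' x <= z.
      by rewrite -[leRHS]h'zE ev_le// ltW.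
    rewrite wE g2E cE W'W ?ax// evK//.
    rewrite g1_small ?ev_ge0 ?ev_le ?ev_ge0 ?(ltW z1)//.
    by rewrite -W'W ?evK ?ev_itv// h'x0 ev_le1.
  have W'a : ev W' a = ev W a by rewrite W'W// lexx ltW.
  have Wa : ev W' x <= ev W a by rewrite -W'a ev_le// ltW.
  have Wy : ev W^-1%g (ev W' x) <= a.
    by rewrite (@ev_le_inv _ W) ?ev_itv// evKV// ev_itv.
  rewrite wE g2E cE h'a ?ev_ge0// evKV ?ev_itv//.
  rewrite g1_small ?ev_ge0 ?evK ?h'a ?x0//.
  by rewrite (le_trans Wa)// ev_le ?ltW.
exists f, g2, w; split => //.
- apply: le_lt_trans (homeo_dist_triangle g1 _ _) _; rewrite [ltRHS]splitr ltrD//.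
  have xi01 : 0 <= xi <= 1 by rewrite ltW.
  apply: le_lt_trans (dist_eq_right xi01 g2g1) _; rewrite g1id ?(ltW xi0)//.
  by apply: le_lt_trans xi_e _; lra.
- have Gg2 : gen2 f g2 g2 by apply: sub_gen; right.
  exact: genM (genM (genV GW') Gg2) GW'.
- apply: le_lt_trans (homeo_dist_triangle h' _ _) _; rewrite [ltRHS]splitr ltrD//.
  by apply: le_lt_trans (dist_eq_left z01 wh') _; rewrite h'zE.
Qed.

End density.

(** * Comeagerness from countably many open dense conditions *)

Theorem theorem1p5 (R : realType) :
  comeager [set fg : homeo_plus R * homeo_plus R |
    dense (generated_subgroup [set fg.1; fg.2])].
Proof.
have [h h_dense] := @homeo_plus_separable R.
(* A code carries the index of a target [h n] and a precision; numbers that code nothing repeat the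
   condition for [(0, 0)]. *)
pose D c : nat * nat := odflt (0, 0) (unpickle c).
pose F c := [set fg : homeo_plus R * homeo_plus R |
  exists2 w, generated_subgroup [set fg.1; fg.2] w &
    (homeo_dist w (h (D c).1) < (D c).2.+1%:R^-1)%R].
exists (\bigcap_c F c).
  exists F => // c; set r := ((D c).2.+1%:R^-1)%R : R.
  have r0 : (0 < r)%R by rewrite invr_gt0.
  split.
    rewrite openE => -[f g] [w Gw wr].
    have wr0 : (0 < r - homeo_dist w (h (D c).1))%R by rewrite subr_gt0.
    have [d d0 dP] := word_continuous Gw wr0.
    apply/nbhs_ballP; exists d => // -[f' g'] [ff' gg'].
    have [||w' Gw' w'w] := dP f' g'; [by rewrite homeo_dist_sym..|].
    exists w' => //; apply: le_lt_trans (homeo_dist_triangle w _ _) _.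
    by rewrite -ltrBrDr.
  move=> O [[f0 g0] Ofg]; rewrite openE => /(_ _ Ofg) /nbhs_ballP[e e0 eO].
  have m0 : (0 < Num.min e r)%R by rewrite lt_min r0 andbT.
  have [f [g [w]]] := approx_pair f0 g0 (h (D c).1) m0.
  rewrite !lt_min => -[/andP[ff0 _] /andP[gg0 _] Gw /andP[_ wr]].
  exists (f, g); split; last by exists w.
  by apply: eO; split; rewrite /ball/= homeo_dist_sym.
(* A pair meeting all conditions generates a dense subgroup: approximate [k] by some [h n], then
   [h n] by a word, each within [e / 2]. *)
move=> [f g] Ffg O [k Ok]; rewrite openE => /(_ _ Ok) /nbhs_ballP[e e0 eO].
have e2 : (0 < e / 2)%R by rewrite divr_gt0.
have [n hk] := h_dense k _ e2.
have [[//|m] _ me] := small_mesh e2.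
have [w Gw] := Ffg (pickle (n, m)) I.
rewrite /D pickleK/= => wh; exists w; split => //; apply: eO.
rewrite /ball/= homeo_dist_sym.
apply: le_lt_trans (homeo_dist_triangle (h n) _ _) _.
by rewrite [ltRHS]splitr ltrD// (lt_trans wh).
Qed.
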